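(* For each $n$ let $\pi_n$ be a uniformly random parking function of length $n$, and let $K_n(\pi_n)$ be its number of cycles. Then $$\frac{K_n(\pi_n)}{\frac12\log n}\longrightarrow 1\quad\text{in probability as } n\to\infty.$$
   Context: Let $[n]=\{1,\dots,n\}$. A parking function of length $n$ is a sequence $\pi_n=(\pi_n(1),\dots,\pi_n(n))\in[n]^n$ such that $|\{k\in[n]:\pi_n(k)\le i\}|\ge i$ for all $i\in[n]$. Viewing $\pi_n$ as a map $[n]\to[n]$, its digraph $G_{\pi_n}$ is the directed graph with vertex set $[n]$ and a directed edge from $i$ to $\pi_n(i)$ for every $i\in[n]$. The number of cycles $K_n(\pi_n)$ is the number of directed cycles in $G_{\pi_n}$ (a fixed point gives a self-loop, which counts as a cycle of length $1$). *)

(* Defs.v *)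
From mathcomp Require Import all_boot all_order all_algebra.
From mathcomp Require Import boolp.

Set Implicit Arguments.
Unset Strict Implicit.
Unset Printing Implicit Defensive.

(* [n] = {1, ..., n} is represented by 'I_n, the element k of [n] being the
   ordinal of value k - 1; hence pi_n(k) <= i and "at least i" shift to
   pi k <= i and "more than i". *)
Definition parking_function (n : nat) (f : {ffun 'I_n -> 'I_n}) : bool :=
  [forall i : 'I_n, i < #|[set k : 'I_n | f k <= i]|].

(* A directed cycle is identified with its set of edges, so that the different
   starting points of a cyclic sequence of vertices give the same cycle. *)
Definition is_dicycle (T : finType) (e : rel T) (E : {set T * T}) : Prop :=
  exists c : seq T,
    [/\ c != [::], ucycle e c & E = [set (x, next c x) | x in c]].

Definition dicycles (T : finType) (e : rel T) : {set {set T * T}} :=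
  [set E | `[< is_dicycle e E >]].

(* frel f is the edge relation x -> f x. *)
Definition num_cycles (n : nat) (f : {ffun 'I_n -> 'I_n}) : nat :=
  #|dicycles (frel f)|.

From mathcomp Require Import all_classical all_reals all_analysis.
Import Order.TTheory GRing.Theory Num.Theory.
Import numFieldNormedType.Exports.

Local Open Scope classical_set_scope.
Local Open Scope ring_scope.

(* X has the uniform distribution on {x | A x}; the finite type V carries the
   discrete sigma-algebra, so measurability is only needed on singletons. *)
Definition uniform_on (d : measure_display) (T : measurableType d)
    (R : realType) (P : probability T R) (V : finType) (A : pred V)
    (X : T -> V) : Prop :=
  forall v : V, measurable (X @^-1` [set v]) /\
    P (X @^-1` [set v]) = (if A v then #|A|%:R^-1 else 0)%:E.

(* The n-th variable may live on its own probability space, which makes sense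
   because the limit is a constant. *)
Definition cvg_in_probability (R : realType) (d : nat -> measure_display)
    (T : forall n, measurableType (d n)) (P : forall n, probability (T n) R)
    (Y : forall n, T n -> R) (c : R) : Prop :=
  forall eps : R, 0 < eps ->
    (fun n => P n [set w | eps < `|Y n w - c|]) @ \oo --> 0%:E.

(* Main.v *)
Require Import Defs.
From mathcomp Require Import all_boot all_order all_algebra.
From mathcomp Require Import all_classical all_reals all_analysis.
From mathcomp Require Import perm.
From mathcomp Require alt action primitive_action.
From mathcomp Require Import zify ring lra.

(** The number K of cycles is controlled by its first two moments, which can be
    computed almost exactly.

    Put N = n + 1. A k-cycle with marked first vertex is a sequence c of k
    distinct vertices whose image under f is c rotated by one step. Permuting
    the arguments of a parking function gives a parking function, so the number
    of parking functions sending c to its rotation depends only on the values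
    taken, and c may be replaced by one fixed sequence a of k positions. Summing
    over c, the expected number of marked k-cycles is the probability that f is
    injective on a ([sum_parking_card_map]).

    Being injective on a is unchanged when a constant is added modulo N to all
    values. By Pollak's circle argument, each map from the n positions to Z/N
    has exactly one translate that is a parking function
    ([unique_parking_rotation]); hence the probability above is the one for a
    uniform map into N values, p_k = N (N - 1) ... (N - k + 1) / N^k
    ([card_parking_map_uniq]). A k-cycle has k possible first vertices, so
    E[K] is the sum M of the p_k / k ([sum_num_cycles]). The same argument for
    ordered pairs of distinct, hence disjoint, cycles of lengths j and k
    produces p_(j+k) / (j k), and p_(j+k) <= p_j p_k; so E[K (K - 1)] <= M^2
    and Var K <= M ([sum_num_cycles_sqr_le]).

    Finally M = (ln n) / 2 + O(1) ([expected_cycles_near_ln]): with s the integer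
    square root of N, the terms k <= s differ from the harmonic sum by O(1)
    because 1 - p_k <= k^2 / N, and the terms k > s are O(1) because the k p_k
    telescope to a sum of at most N. Chebyshev's inequality around (ln n) / 2
    concludes. *)

Set Implicit Arguments.
Unset Strict Implicit.
Unset Printing Implicit Defensive.
Import Order.TTheory GRing.Theory Num.Theory.
Import numFieldNormedType.Exports.

(** * The circular parking lot *)

(** The values range over one more spot than there are cars, so that they can
    be translated modulo n + 1; the condition forces spot n to be avoided. *)
Definition circular_parking n (g : {ffun 'I_n -> 'I_n.+1}) : bool :=
  [forall i : 'I_n, i < #|[set k | g k <= i]|].

Definition rotate n (s : 'I_n.+1) (g : {ffun 'I_n -> 'I_n.+1}) :
  {ffun 'I_n -> 'I_n.+1} := [ffun k => (g k - s)%R].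

Definition cars_before n (g : {ffun 'I_n -> 'I_n.+1}) (u : nat) : nat :=
  #|[set k | g k < u]|.

Lemma val_ord_sub n (a s : 'I_n.+1) :
  (a - s)%R = (if s <= a then a - s else a + n.+1 - s) :> nat.
Proof.
have := ltn_ord a; have := ltn_ord s => /= Hs Ha.
case: leqP => H; rewrite /= modnDmr.
- have -> : a + (n.+1 - s) = (a - s) + n.+1 by lia.
  by rewrite modnDr modn_small //; lia.
- rewrite modn_small; lia.
Qed.

Lemma card_set_sum (T : finType) (p : pred T) : #|[set x | p x]| = \sum_x p x.
Proof.
rewrite cardsE -sum1_card big_mkcond; apply: eq_bigr => x _.
by rewrite unfold_in; case: (p x).
Qed.

Lemma cars_before_rotate n (g : {ffun 'I_n -> 'I_n.+1}) (s : 'I_n.+1) t :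
  t <= n.+1 ->
  cars_before (rotate s g) t + cars_before g s =
  if s + t < n.+1 then cars_before g (s + t)
  else n + cars_before g (s + t - n.+1).
Proof.
move=> tn; have sn := ltn_ord s.
have cn : n = \sum_(k < n) 1 by rewrite sum1_card card_ord.
rewrite /cars_before !card_set_sum -big_split /=.
case: ltnP => st.
  apply: eq_bigr => k _; rewrite ffunE val_ord_sub; have := ltn_ord (g k).
  by case: (leqP s (g k)) => ?; lia.
rewrite [X in X + _]cn -big_split /=.
apply: eq_bigr => k _; rewrite ffunE val_ord_sub; have := ltn_ord (g k).
by case: (leqP s (g k)) => ?; lia.
Qed.

(** The height [cars_before g u - u], made nonnegative by adding n + 1, with ties
    broken by the position u: comparing keys compares the pairs (height,
    position) lexicographically, so the key is smallest at the first position
    of least height. *)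
Definition rotation_key n (g : {ffun 'I_n -> 'I_n.+1}) (u : nat) : nat :=
  (cars_before g u + (n.+1 - u)) * n.+1 + u.

Lemma ltn_digit2 N a b s u : s < N -> u < N ->
  (a * N + s < b * N + u) = (a < b) || (a == b) && (s < u).
Proof.
move=> sN uN; case: (ltngtP a b) => [ab|ab|->] /=; last by rewrite ltn_add2l.
- by have : a.+1 * N <= b * N by [rewrite leq_mul2r ab orbT]; lia.
- by have : b.+1 * N <= a * N by [rewrite leq_mul2r ab orbT]; lia.
Qed.

(** Cycle lemma. Reading the circle from s, the parking condition says that the
    height never drops below its value at s. Going once around the circle lowers
    the height by 1, so for positions before s, reached after the wrap-around,
    the comparison becomes strict. *)
Lemma circular_parking_rotate n (g : {ffun 'I_n -> 'I_n.+1}) (s : 'I_n.+1) :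
  circular_parking (rotate s g) =
  [forall u : 'I_n.+1, (u != s) ==> (rotation_key g s < rotation_key g u)].
Proof.
have sn := ltn_ord s.
have cE t : cars_before (rotate s g) t.+1 = #|[set k | rotate s g k <= t]|.
  by rewrite /cars_before; apply: eq_card => k; rewrite !inE ltnS.
apply/forallP/forallP => [H u|H t].
  apply/implyP => us; rewrite /rotation_key ltn_digit2 //.
  have un := ltn_ord u.
  have cbr := @cars_before_rotate n g s.
  case: (ltngtP u s) => [lt|gt|/val_inj eq]; last by rewrite eq eqxx in us.
    have tn : u + n.+1 - s < n.+1 by lia.
    have tn1 : u + n.+1 - s - 1 < n by lia.
    have := cbr _ (ltnW tn); have := H (Ordinal tn1); rewrite -cE /=.
    rewrite (_ : (_ - 1).+1 = u + n.+1 - s); last by lia.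
    rewrite (_ : s + (u + n.+1 - s) = u + n.+1) ?addnK; last by lia.
    by case: ifP => ? ? ?; lia.
  have tn : u - s < n.+1 by lia.
  have tn1 : u - s - 1 < n by lia.
  have := cbr _ (ltnW tn); have := H (Ordinal tn1); rewrite -cE /=.
  rewrite (_ : (_ - 1).+1 = u - s); last by lia.
  rewrite (_ : s + (u - s) = u); last by lia.
  by case: ifP => ? ? ?; lia.
have tn := ltn_ord t.
have tn1 : t.+1 <= n.+1 by lia.
rewrite -cE; have := cars_before_rotate g s tn1.
case: ltnP => st.
  have /implyP := H (Ordinal st); rewrite /rotation_key ltn_digit2 //=.
  have -> : Ordinal st != s by apply/eqP => /(congr1 val) /=; lia.
  move=> /(_ isT); lia.
have un : s + t.+1 - n.+1 < n.+1 by lia.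
have /implyP := H (Ordinal un); rewrite /rotation_key ltn_digit2 //=.
have -> : Ordinal un != s by apply/eqP => /(congr1 val) /=; lia.
move=> /(_ isT); lia.
Qed.

(** Pollak's circle argument: the keys are distinct, hence have exactly one
    minimum. *)
Lemma unique_parking_rotation n (g : {ffun 'I_n -> 'I_n.+1}) :
  #|[set s | circular_parking (rotate s g)]| = 1.
Proof.
set m := [arg min_(u < (ord0 : 'I_n.+1)) rotation_key g u].
have mP u : u != m -> rotation_key g m < rotation_key g u.
  rewrite /m; case: arg_minnP => // v _ /(_ u isT) vu uv.
  rewrite ltn_neqAle vu andbT; apply: contra_neq uv => E.
  move: E; rewrite /rotation_key => /(congr1 (modn^~ n.+1)).
  by rewrite !modnMDl !modn_small // => /val_inj ->.
apply/eqP/cards1P; exists m; apply/setP => s; rewrite !inE circular_parking_rotate.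
apply/forallP/eqP => [H|-> u]; last by apply/implyP => /mP.
apply/eqP; apply: contraT => sm; have := mP _ sm.
have /implyP := H m; rewrite eq_sym => /(_ sm); lia.
Qed.

Lemma rotateK n (s : 'I_n.+1) : cancel (rotate s) (rotate (- s)%R).
Proof. by move=> g; apply/ffunP => k; rewrite !ffunE opprK addrNK. Qed.

Lemma rotateVK n (s : 'I_n.+1) : cancel (rotate (- s)%R) (rotate s).
Proof. by move=> g; apply/ffunP => k; rewrite !ffunE opprK addrK. Qed.

(** Count the pairs (g, s) such that g has the property and its rotation by s is
    a parking function: by [unique_parking_rotation] once per g, and once per s
    and per parking function with the property. *)
Lemma card_invariant_circular_parking n (Q : pred {ffun 'I_n -> 'I_n.+1}) :
  (forall s g, Q (rotate s g) = Q g) ->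
  n.+1 * #|[set g | circular_parking g & Q g]| = #|[set g | Q g]|.
Proof.
move=> Qrot.
have -> : #|[set g | Q g]| =
    \sum_(g | Q g) \sum_(s : 'I_n.+1) circular_parking (rotate s g).
  rewrite cardsE -sum1_card; apply: eq_bigr => g _.
  by rewrite -card_set_sum unique_parking_rotation.
rewrite exchange_big /= -[X in X * _]card_ord -sum_nat_const.
apply: eq_bigr => s _; rewrite card_set_sum.
rewrite [RHS]big_mkcond /=.
rewrite [LHS](reindex (rotate s)); last first.
  by exists (rotate (- s)%R) => g _; [exact: rotateK|exact: rotateVK].
by apply: eq_bigr => g _; rewrite Qrot; case: (Q g); rewrite ?andbT ?andbF.
Qed.

Definition widen_values n (f : {ffun 'I_n -> 'I_n}) : {ffun 'I_n -> 'I_n.+1} :=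
  [ffun k => widen_ord (leqnSn n) (f k)].

Lemma card_circular_parking n (Q : pred {ffun 'I_n -> 'I_n.+1}) :
  #|[set f | parking_function f & Q (widen_values f)]| =
  #|[set g | circular_parking g & Q g]|.
Proof.
have winj : injective (@widen_values n).
  move=> f f' /ffunP E; apply/ffunP => k; have := E k; rewrite !ffunE.
  by move/(congr1 val) => /= /val_inj.
have wP f : circular_parking (widen_values f) = parking_function f.
  apply: eq_forallb => i; congr (_ < _).
  by apply: eq_card => k; rewrite !inE ffunE.
rewrite -(card_imset _ winj); apply: eq_card => g; rewrite inE.
apply/imsetP/andP => [[f]|[gP gQ]].
  by rewrite inE -wP => /andP[fP fQ] ->.
have gn k : g k < n.
  have n0 : n.-1 < n by have := ltn_ord k; lia.
  have /forallP/(_ (Ordinal n0)) /= lt := gP.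
  have : [set j | g j <= n.-1] == [set: 'I_n].
    by rewrite eqEcard finset.subsetT cardsT card_ord /=; apply: leq_trans lt; lia.
  by move/eqP/setP/(_ k); rewrite !inE => le; apply: leq_ltn_trans le n0.
have wg : widen_values [ffun k => Ordinal (gn k)] = g.
  by apply/ffunP => k; rewrite !ffunE; apply: val_inj.
exists [ffun k => Ordinal (gn k)] => //.
by rewrite inE -wP wg gP gQ.
Qed.

Lemma card_ffun_map_eq (T U : finType) (a : seq T) (b : seq U) :
  uniq a -> size b = size a ->
  #|[set g : {ffun T -> U} | [seq g x | x <- a] == b]| = #|U| ^ (#|T| - size a).
Proof.
move=> ua sb.
case: (pickP U) => [u0 _|U0]; last first.
  case: b sb => [|b]; last by have := U0 b.
  move/esym/size0nil => -> /=; rewrite subn0 -card_ffun -cardsT.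
  by apply: eq_card => g; rewrite !inE.
pose F x := if x \in a then pred1 (nth u0 b (index x a)) else predT.
have -> : #|[set g : {ffun T -> U} | [seq g x | x <- a] == b]| = #|family F|.
  apply: eq_card => g; rewrite inE.
  apply/eqP/familyP => [E x|E].
    rewrite /F; case: ifP => // xa; rewrite inE -E (nth_map x) ?index_mem //.
    by rewrite nth_index.
  apply: (@eq_from_nth _ u0); rewrite size_map // => i ia.
  have x0 : T by case: a ia {ua sb F E} => // x.
  rewrite (nth_map x0) //; have := E (nth x0 a i).
  by rewrite /F mem_nth // inE index_uniq // => /eqP.
rewrite card_family foldrE big_map -(big_map id xpredT (fun x => #|F x|)) /=.
rewrite map_id big_enum /= (bigID (mem a)) /= big1 ?mul1n; last first.
  by move=> x xa; rewrite /F xa card1.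
rewrite (eq_bigr (fun=> #|U|)) => [|x /negbTE xa]; last by rewrite /F xa; apply: eq_card.
rewrite prod_nat_const; congr (_ ^ _).
rewrite -(card_uniqP ua) -(cardC (mem a)) addKn.
by apply: eq_card => x.
Qed.

Lemma card_map_uniq_sum (T U : finType) k (A : {set {ffun T -> U}})
    (a : k.-tuple T) :
  #|[set f in A | uniq [seq f x | x <- a]]| =
  \sum_(b : k.-tuple U | uniq b) #|[set f in A | map_tuple f a == b]|.
Proof.
rewrite -sum1_card.
rewrite (partition_big (fun f : {ffun T -> U} => map_tuple f a)
                       (fun b : k.-tuple U => uniq b)) /=; last first.
  by move=> f; rewrite inE => /andP[].
apply: eq_bigr => b ub; rewrite -sum1_card; apply: eq_bigl => f.
rewrite !inE -andbA -!val_eqE /=.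
by case: eqP => [->|_]; rewrite ?andbF ?ub ?andbT.
Qed.

Lemma card_uniq_tuple (U : finType) k :
  #|[set t : k.-tuple U | uniq t]| = #|U| ^_ k.
Proof.
rewrite -(card_uniq_tuples k (@predT U)); apply: eq_card => t.
by rewrite !inE all_predT.
Qed.

Lemma card_ffun_map_uniq (T U : finType) (a : seq T) : uniq a ->
  #|[set g : {ffun T -> U} | uniq [seq g x | x <- a]]| =
  #|U| ^_ (size a) * #|U| ^ (#|T| - size a).
Proof.
move=> ua; have /= := @card_map_uniq_sum T U _ [set: {ffun T -> U}] (in_tuple a).
rewrite (_ : [set f in [set: {ffun T -> U}] | _] =
             [set g : {ffun T -> U} | uniq [seq g x | x <- a]]); last first.
  by apply/setP => f; rewrite !inE.
move->; rewrite (eq_bigr (fun=> #|U| ^ (#|T| - size a))).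
  by rewrite sum_nat_const -card_uniq_tuple cardsE.
move=> b _; rewrite -(card_ffun_map_eq ua (size_tuple b)).
by apply: eq_card => g; rewrite !inE -val_eqE.
Qed.

(** Injectivity on given positions is invariant under rotation, so among parking
    functions it has the same probability as among all maps into n + 1 values. *)
Lemma card_parking_map_uniq n (a : seq 'I_n) : uniq a ->
  n.+1 * #|[set f | @parking_function n f & uniq [seq f k | k <- a]]| =
  n.+1 ^_ (size a) * n.+1 ^ (n - size a).
Proof.
move=> ua; pose Q (g : {ffun 'I_n -> 'I_n.+1}) := uniq [seq g k | k <- a].
have -> : #|[set f | @parking_function n f & uniq [seq f k | k <- a]]| =
    #|[set f | parking_function f & Q (widen_values f)]|.
  apply: eq_card => f; rewrite !inE; congr (_ && _).
  rewrite /Q (_ : [seq _ | k <- a] = map (widen_ord (leqnSn n)) [seq f k | k <- a]).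
    by rewrite [RHS]map_inj_uniq // => x y /(congr1 val) /= /val_inj.
  by rewrite -map_comp; apply: eq_map => k; rewrite /= ffunE.
rewrite card_circular_parking card_invariant_circular_parking.
  by rewrite card_ffun_map_uniq // !card_ord.
move=> s g; rewrite /Q (_ : [seq _ | k <- a] = map (fun x => (x - s)%R) [seq g k | k <- a]).
  by rewrite map_inj_uniq //; apply: addIr.
by rewrite -map_comp; apply: eq_map => k; rewrite /= ffunE.
Qed.

Lemma card_parking n : n.+1 * #|[set f | @parking_function n f]| = n.+1 ^ n.
Proof.
have := @card_parking_map_uniq n [::] isT; rewrite /= ffactn0 mul1n subn0 => <-.
by congr (_ * _); apply: eq_card => f; rewrite !inE andbT.
Qed.

(** * Cycles as tuples *)

(** In this form the cycle condition prescribes the values of f at the entries of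
    c, as is needed for counting the functions f. *)
Lemma fcycleE (T : eqType) (f : T -> T) (c : seq T) :
  fcycle f c = ([seq f x | x <- c] == rot 1 c).
Proof.
case: c => [|x s]; [by rewrite eqxx|rewrite /=].
rewrite rot1_cons -[LHS]/(fpath f x (rcons s x)).
have -> : f x :: map f s = map f (belast x (rcons s x)) by rewrite belast_rcons.
move: (rcons s x) => q; elim: q x => [|z q IH] y //=.
by rewrite eqseq_cons IH.
Qed.

Definition cycle_edges (T : finType) (c : seq T) : {set T * T} :=
  [set (x, next c x) | x in c].

(** For c a concatenation of two blocks, the first of size j, the equation
    [map f c = rot_blocks j c] says that both blocks are cycles of f. *)
Definition rot_blocks T j (c : seq T) : seq T :=
  rot 1 (take j c) ++ rot 1 (drop j c).

Lemma size_rot_blocks T j (c : seq T) : size (rot_blocks j c) = size c.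
Proof. by rewrite size_cat !size_rot -size_cat cat_take_drop. Qed.

Lemma rot_blocks_tupleP T j n (c : n.-tuple T) : size (rot_blocks j c) == n.
Proof. by rewrite size_rot_blocks size_tuple. Qed.

Lemma rot_blocks_inj T j n :
  injective (fun c : n.-tuple T => Tuple (rot_blocks_tupleP j c)).
Proof.
move=> c c' /(congr1 val) /= E; apply: val_inj => /=.
rewrite -(cat_take_drop j c) -(cat_take_drop j c').
have s : size (take j c) = size (take j c') by rewrite !size_take !size_tuple.
have := congr1 (take (size (take j c))) E; have := congr1 (drop (size (take j c))) E.
rewrite /rot_blocks -{1 3}(size_rot 1 (take j c)) take_size_cat // drop_size_cat //.
rewrite s -(size_rot 1 (take j c')) take_size_cat // drop_size_cat //.
by move=> /rot_inj -> /rot_inj ->.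
Qed.

Section FunctionalCycles.
Variables (T : finType) (f : T -> T).
Implicit Types (c : seq T) (x : T) (E : {set T * T}).

Lemma ufcycle_edgesE c : fcycle f c ->
  cycle_edges c = [set p : T * T | (p.1 \in c) && (p.2 == f p.1)].
Proof.
move=> fc; apply/setP => -[x y]; rewrite inE /=.
apply/imsetP/andP => [[z zc [-> ->]]|[xc /eqP ->]].
  by split=> //; rewrite eq_sym; apply: (next_cycle fc zc).
by exists x => //; have /eqP -> := next_cycle fc xc.
Qed.

Lemma mem_ufcycle_edges c x : fcycle f c -> ((x, f x) \in cycle_edges c) = (x \in c).
Proof. by move=> fc; rewrite ufcycle_edgesE // inE eqxx andbT. Qed.

Lemma card_ufcycle_edges c : fcycle f c -> uniq c -> #|cycle_edges c| = size c.
Proof.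
move=> fc uc; rewrite card_imset; first exact/card_uniqP.
by move=> x y [].
Qed.

Lemma ufcycle_mem_orbit c x : fcycle f c -> uniq c -> x \in c ->
  c =i fingraph.orbit f x.
Proof.
by move=> fc uc /(orbit_rot_cycle fc uc)[i ->] y; rewrite mem_rot.
Qed.

Lemma ufcycle_cons_orbit x c : fcycle f (x :: c) -> uniq (x :: c) ->
  x :: c = fingraph.orbit f x.
Proof.
move=> fc uc; have [i E] := orbit_rot_cycle fc uc (mem_head x c).
have := congr1 size E; rewrite size_rot size_orbit /= => oE.
rewrite /fingraph.orbit oE /=; congr (_ :: _).
move: fc; rewrite /= rcons_path => /andP[/fpathP[m ->] _].
by rewrite size_traject.
Qed.

(** Both cycles run through the orbit of the common vertex. *)
Lemma ufcycle_edges_inter c c' x : fcycle f c -> uniq c -> fcycle f c' -> uniq c' ->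
  x \in c -> x \in c' -> cycle_edges c = cycle_edges c'.
Proof.
move=> fc uc fc' uc' xc xc'; rewrite !ufcycle_edgesE //; apply/setP => p.
by rewrite !inE (ufcycle_mem_orbit fc uc xc) (ufcycle_mem_orbit fc' uc' xc').
Qed.

Definition dicycles_of_size k : {set {set T * T}} :=
  [set E in dicycles (frel f) | #|E| == k].

Definition ufcycles k : {set k.-tuple T} := [set c : k.-tuple T | ucycleb (frel f) c].

Lemma dicyclesP E : reflect
  (exists c, [/\ c != [::], fcycle f c, uniq c & E = cycle_edges c])
  (E \in dicycles (frel f)).
Proof.
rewrite inE; apply: (iffP (@asboolP _)) => -[c].
  by case=> c0 /andP[fc uc] ->; exists c.
by case=> c0 fc uc ->; exists c; split=> //; apply/andP.
Qed.

Lemma ufcycles_size k (c : k.-tuple T) : 0 < k -> c \in ufcycles k ->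
  cycle_edges c \in dicycles_of_size k.
Proof.
move=> k0; rewrite inE => /andP[fc uc].
rewrite inE card_ufcycle_edges // size_tuple eqxx andbT.
by apply/dicyclesP; exists c; split=> //; rewrite -size_eq0 size_tuple -lt0n.
Qed.

(** A cycle is determined by its edges and its first vertex, which can be any of
    its k vertices. *)
Lemma card_ufcycles_edges k E : E \in dicycles_of_size k ->
  #|[set c in ufcycles k | cycle_edges c == E]| = k.
Proof.
rewrite inE => /andP[/dicyclesP[c0 [c0N fc0 uc0 E0]] /eqP Ek].
have k0 : size c0 = k by rewrite -Ek E0 card_ufcycle_edges.
case: c0 => // x0 s0 in c0N fc0 uc0 E0 k0 *.
set A := [set c in _ | _].
have AP (c : k.-tuple T) : c \in A ->
    [/\ fcycle f c, uniq c, c =i x0 :: s0 & c = fingraph.orbit f (head x0 c) :> seq T].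
  rewrite !inE => /andP[/andP[fc uc] /eqP cE]; split=> //.
    by move=> x; rewrite -!(mem_ufcycle_edges _) // cE E0.
  move: fc uc (size_tuple c).
  case: (tval c) => [_ _ /= k0'|x s fc uc _]; first by move: k0; rewrite -k0'.
  exact: ufcycle_cons_orbit.
have hinj : {in A &, injective (fun c : k.-tuple T => head x0 c)}.
  move=> c c' /AP[_ _ _ cE] /AP[_ _ _ cE'] hE; apply: val_inj => /=.
  by rewrite cE hE -cE'.
rewrite -(card_in_imset hinj) -[RHS]k0 -(card_uniqP uc0).
apply: eq_card => x; apply/imsetP/idP => [[c cA ->]|xc0].
  have [_ _ cE _] := AP c cA; rewrite -cE memtE.
  have := size_tuple c; case: (tval c) => [/= k0'|y s _]; last by rewrite mem_head.
  by move: k0; rewrite -k0'.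
have [i s iE] := rot_to xc0.
have sk : size (rot i (x0 :: s0)) == k by rewrite size_rot k0.
exists (Tuple sk); last by rewrite /= iE.
rewrite !inE /= /ucycleb rot_cycle rot_uniq fc0 uc0 /= E0.
rewrite !ufcycle_edgesE ?rot_cycle //.
by apply/eqP/setP => p; rewrite !inE mem_rot.
Qed.

Lemma card_ufcycles k : 0 < k -> #|ufcycles k| = k * #|dicycles_of_size k|.
Proof.
move=> k0; rewrite -sum1_card.
rewrite (partition_big (fun c : k.-tuple T => cycle_edges c)
          (mem (dicycles_of_size k))) /=; last by move=> c; apply: ufcycles_size.
rewrite mulnC -sum_nat_const; apply: eq_bigr => E Ek.
rewrite -[RHS](card_ufcycles_edges Ek) -sum1_card.
by apply: eq_bigl => c; rewrite !inE.
Qed.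

Definition dicycle_pairs j k : {set {set T * T} * {set T * T}} :=
  [set p | [&& p.1 \in dicycles_of_size j, p.2 \in dicycles_of_size k & p.1 != p.2]].

(** Choosing a first vertex on each of two distinct cycles gives j * k pairs of
    sequences; their concatenation is duplicate-free because distinct cycles
    share no vertex. *)
Lemma card_dicycle_pairs j k :
  j * k * #|dicycle_pairs j k| <=
  #|[set c : (j + k).-tuple T | uniq c & [seq f x | x <- c] == rot_blocks j c]|.
Proof.
pose A := \bigcup_(p in dicycle_pairs j k)
  finset.setX [set c in ufcycles j | cycle_edges c == p.1]
       [set c in ufcycles k | cycle_edges c == p.2].
have -> : j * k * #|dicycle_pairs j k| = #|A|.
  rewrite mulnC -sum_nat_const.
  have -> : #|A| = \sum_(p in dicycle_pairs j k)
     #|finset.setX [set c in ufcycles j | cycle_edges c == p.1]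
            [set c in ufcycles k | cycle_edges c == p.2]|.
    rewrite -[LHS]sum1_card.
    rewrite (partition_big
       (fun q : j.-tuple T * k.-tuple T => (cycle_edges q.1, cycle_edges q.2))
       (mem (dicycle_pairs j k))) /=; last first.
      move=> [c c'] /bigcupP[p pP]; rewrite finset.in_setX => /andP[].
      rewrite inE => /andP[_ /eqP E]; rewrite inE => /andP[_ /eqP E'] /=.
      by rewrite E E' -surjective_pairing.
    apply: eq_bigr => -[E E'] pP; rewrite -sum1_card; apply: eq_bigl => -[c c'] /=.
    apply/andP/idP.
      move=> [/bigcupP[p _]]; rewrite !inE /= => /andP[/andP[-> _] /andP[-> _]].
      by rewrite xpair_eqE => /andP[-> ->].
    move=> H; split; first by apply/bigcupP; exists (E, E').
    by move: H; rewrite !inE /= xpair_eqE => /andP[/andP[_ ->] /andP[_ ->]].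
  apply: eq_bigr => -[E E']; rewrite inE => /and3P[/= Ej Ek _].
  by rewrite cardsX !card_ufcycles_edges.
pose cat2 (q : j.-tuple T * k.-tuple T) : (j + k).-tuple T := cat_tuple q.1 q.2.
have cinj : injective cat2.
  move=> [c c'] [d d'] /(congr1 val) /= /eqP; rewrite eqseq_cat ?size_tuple //.
  by move=> /andP[/eqP/val_inj -> /eqP/val_inj ->].
rewrite -(card_imset _ cinj); apply: subset_leq_card;
apply/fintype.subsetP => _ /imsetP[[c c'] + ->].
move=> /bigcupP[[E E']]; rewrite !inE /= => /and3P[_ _ NE].
move=> /andP[/andP[/andP[fc uc] /eqP cE] /andP[/andP[fc' uc'] /eqP cE']].
rewrite /rot_blocks take_size_cat ?drop_size_cat ?size_tuple // map_cat.
move: (fc) (fc'); rewrite !fcycleE => /eqP -> /eqP ->; rewrite eqxx andbT.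
rewrite cat_uniq uc uc' andbT /=; apply/hasPn => x xc'; apply: contra NE => xc.
by rewrite -cE -cE' (ufcycle_edges_inter fc uc fc' uc' xc xc').
Qed.

End FunctionalCycles.

(** * Relabelling the positions *)

(** This is the k-transitivity of the symmetric group. *)
Lemma uniq_tuple_perm (T : finType) k (a b : k.-tuple T) : uniq a -> uniq b ->
  exists s : {perm T}, [seq s x | x <- a] = b.
Proof.
move=> ua ub.
have kT : k <= #|T| by rewrite -(size_tuple a) -(card_uniqP ua) max_card.
have tr := @primitive_action.ntransitive_weak _ _ _ (alt.Sym_group T) _ _ _
  kT (alt.Sym_trans T).
have mem (c : k.-tuple T) : uniq c -> c \in primitive_action.dtuple_on k [set: T].
  by move=> uc; rewrite inE uc; apply/fintype.subsetP => x _; rewrite inE.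
have [s _ E] := action.atransP2 tr (mem a ua) (mem b ub).
by exists s; rewrite E.
Qed.

Lemma parking_function_perm n (f : {ffun 'I_n -> 'I_n}) (s : {perm 'I_n}) :
  parking_function [ffun k => f (s k)] = parking_function f.
Proof.
apply: eq_forallb => i; congr (_ < _); rewrite !card_set_sum.
rewrite [RHS](reindex_inj (@perm.perm_inj _ s)) /=.
by apply: eq_bigr => k _; rewrite ffunE.
Qed.

(** A parking function remains one when its arguments are permuted, so only the
    prescribed values b matter, not the positions at which they are taken. *)
Lemma card_parking_map_perm n k (a a' b : k.-tuple 'I_n) : uniq a -> uniq a' ->
  #|[set f in [set f | @parking_function n f] | map_tuple f a == b]| =
  #|[set f in [set f | @parking_function n f] | map_tuple f a' == b]|.
Proof.
move=> ua ua'; have [s E] := uniq_tuple_perm ua' ua.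
pose h (f : {ffun 'I_n -> 'I_n}) : {ffun 'I_n -> 'I_n} := [ffun k => f (s k)].
have hinj : injective h.
  move=> f g /ffunP fg; apply/ffunP => x; have := fg (perm.perm_inv s x).
  by rewrite !ffunE perm.permKV.
have hbij := injF_bij hinj.
rewrite !card_set_sum [RHS](reindex_inj hinj) /=; apply: eq_bigr => f _.
rewrite !inE parking_function_perm -!val_eqE /= -E -map_comp.
by congr (nat_of_bool (_ && (_ == _))); apply: eq_map => x; rewrite /= ffunE.
Qed.

(** For each c, move the positions c to fixed positions a; then, r c running over
    all duplicate-free tuples, the total counts the parking functions that are
    injective on a. With r a rotation this counts marked cycles, and with r the
    rotation of two blocks it counts pairs of marked cycles. *)
Lemma sum_parking_card_map n k (r : k.-tuple 'I_n -> k.-tuple 'I_n) :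
  injective r -> (forall c, perm_eq (r c) c) -> k <= n ->
  n.+1 * \sum_(f | @parking_function n f)
     #|[set c : k.-tuple 'I_n | uniq c & map_tuple f c == r c]| =
  n.+1 ^_ k * n.+1 ^ (n - k).
Proof.
move=> rinj rperm kn.
have sa : size (take k (enum 'I_n)) == k by rewrite size_takel // size_enum_ord.
pose a : k.-tuple 'I_n := Tuple sa.
have ua : uniq a by rewrite take_uniq // enum_uniq.
have := card_parking_map_uniq ua; rewrite (eqP sa) => <-; congr (_ * _).
have := card_map_uniq_sum [set f | @parking_function n f] a.
rewrite (_ : [set f in [set f | @parking_function n f] | _] =
  [set f | @parking_function n f & uniq [seq f x | x <- a]]); last first.
  by apply/setP => f; rewrite !inE.
move=> ->.
rewrite [RHS](reindex_inj rinj) /=.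
rewrite [RHS](eq_bigl (fun c : k.-tuple 'I_n => uniq c)); last first.
  by move=> c; apply: perm_uniq.
rewrite [RHS](eq_bigr (fun c : k.-tuple 'I_n =>
  #|[set f in [set f | @parking_function n f] | map_tuple f c == r c]|)); last first.
  by move=> c uc; apply: card_parking_map_perm.
under eq_bigr do rewrite card_set_sum.
under [RHS]eq_bigr do rewrite card_set_sum.
rewrite exchange_big [LHS]/= [RHS]big_mkcond; apply: eq_bigr => c _ /=.
rewrite big_mkcond /=; case: (uniq c) => /=; last by rewrite big1 // => f _; case: ifP.
by apply: eq_bigr => f _; rewrite !inE; case: ifP.
Qed.

(** * The first two moments of the number of cycles *)

Lemma dicycle_size n (f : {ffun 'I_n -> 'I_n}) E :
  E \in dicycles (frel f) -> 0 < #|E| < n.+1.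
Proof.
case/dicyclesP=> c [c0 fc uc ->]; rewrite (card_ufcycle_edges fc uc) ltnS.
rewrite lt0n size_eq0 c0 -(card_uniqP uc).
by apply: leq_trans (max_card _) _; rewrite card_ord.
Qed.

Lemma sum_nat_delta m n s : m <= s < n -> \sum_(m <= k < n) (s == k) = 1.
Proof.
move=> /andP[ms sn]; rewrite (@big_cat_nat _ _ _ s) ?(ltnW sn) //=.
rewrite big_nat big1 ?add0n => [|k /andP[_ ks]]; last by rewrite gtn_eqF.
rewrite big_ltn // eqxx big_nat big1 ?addn0 // => k /andP[ks _].
by rewrite ltn_eqF.
Qed.

Lemma num_cycles_by_size n (f : {ffun 'I_n -> 'I_n}) :
  num_cycles f = \sum_(1 <= k < n.+1) #|dicycles_of_size f k|.
Proof.
rewrite /num_cycles -sum1_card.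
rewrite (eq_bigr (fun E : {set 'I_n * 'I_n} => \sum_(1 <= k < n.+1) (#|E| == k))).
  rewrite exchange_big; apply: eq_bigr => k _ /=.
  by rewrite /dicycles_of_size card_set_sum big_mkcond /=; apply: eq_bigr => E _; case: ifP.
by move=> E /dicycle_size/sum_nat_delta ->.
Qed.

Lemma num_cycles_pairs_by_size n (f : {ffun 'I_n -> 'I_n}) :
  num_cycles f * num_cycles f = num_cycles f +
  \sum_(1 <= j < n.+1) \sum_(1 <= k < n.+1) #|dicycle_pairs f j k|.
Proof.
set D := dicycles (frel f).
have -> : \sum_(1 <= j < n.+1) \sum_(1 <= k < n.+1) #|dicycle_pairs f j k| =
    #|[set p : {set 'I_n * 'I_n} * {set 'I_n * 'I_n} |
        [&& p.1 \in D, p.2 \in D & p.1 != p.2]]|.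
  rewrite card_set_sum.
  rewrite (eq_bigr (fun p : {set 'I_n * 'I_n} * {set 'I_n * 'I_n} =>
    \sum_(1 <= j < n.+1) \sum_(1 <= k < n.+1) (p \in dicycle_pairs f j k))).
    rewrite [RHS]exchange_big; apply: eq_bigr => j _ /=.
    rewrite [RHS]exchange_big; apply: eq_bigr => k _ /=.
    by rewrite -card_set_sum; apply: eq_card => p; rewrite [RHS]inE.
  move=> [E E'] _ /=.
  transitivity (\sum_(1 <= j < n.+1) \sum_(1 <= k < n.+1)
      [&& E \in D, E' \in D & E != E'] * (#|E| == j) * (#|E'| == k)); last first.
    apply: eq_bigr => j _; apply: eq_bigr => k _.
    rewrite [in RHS]inE [_ \in dicycles_of_size _ _]inE [_ \in dicycles_of_size _ k]inE /= -/D.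
    by case: (E \in D); case: (E' \in D); case: (_ == j); case: (_ == k); case: (E != E').
  case: and3P => [[ED E'D _]|_]; last first.
    by rewrite big1 // => j _; rewrite big1.
  under eq_bigr => j _ do
    rewrite -big_distrr /= (sum_nat_delta (dicycle_size E'D)) muln1 mul1n.
  by rewrite (sum_nat_delta (dicycle_size ED)).
rewrite /num_cycles -/D; clearbody D; rewrite -cardsX -(cardsID [set p | p.1 == p.2]); congr (_ + _).
  have dinj : injective (fun E : {set 'I_n * 'I_n} => (E, E)) by move=> E E' [].
  rewrite -(card_imset _ dinj); apply: eq_card => -[E E']; rewrite !inE /=.
  apply/andP/imsetP => [[/andP[ED _] /eqP <-]|[E0 ED [-> ->]]]; first by exists E.
  by rewrite !ED eqxx.
by apply: eq_card => -[E E']; rewrite !inE /= andbC andbA.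
Qed.

Local Open Scope ring_scope.

Section Moments.
Variable R : realType.

(** The probability that a uniform random map into m values is injective on k
    given points. *)
Definition injection_prob (m k : nat) : R := (m ^_ k)%:R / m%:R ^+ k.

Definition expected_cycles n : R :=
  \sum_(1 <= k < n.+1) injection_prob n.+1 k / k%:R.

Lemma card_parking_gt0 n : 0 < #|[set f | @parking_function n f]|%:R :> R.
Proof.
rewrite ltr0n; have := card_parking n; case: posnP => // ->.
by rewrite muln0 => /esym/eqP; rewrite expn_eq0.
Qed.

Lemma sum_parking_card_mapE n k (r : k.-tuple 'I_n -> k.-tuple 'I_n) :
  injective r -> (forall c, perm_eq (r c) c) -> (k <= n)%N ->
  \sum_(f | @parking_function n f)
     #|[set c : k.-tuple 'I_n | uniq c & map_tuple f c == r c]|%:R =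
  #|[set f | @parking_function n f]|%:R * injection_prob n.+1 k.
Proof.
move=> rinj rperm kn; have n0 : n.+1%:R != 0 :> R by rewrite pnatr_eq0.
apply: (mulfI n0); rewrite mulrA -[X in X * injection_prob _ _]natrM card_parking.
rewrite -natr_sum -natrM sum_parking_card_map // natrM !natrX.
have -> : n.+1%:R ^+ n = n.+1%:R ^+ (n - k) * n.+1%:R ^+ k :> R.
  by rewrite -exprD subnK.
by rewrite /injection_prob mulrCA -mulrA mulfV ?mulr1 // expf_neq0.
Qed.

(** For k > n no tuple is duplicate-free, whereas [injection_prob n.+1 n.+1] is
    positive. Such k arise as sums of the lengths of two cycles. *)
Lemma sum_parking_card_map_le n k (r : k.-tuple 'I_n -> k.-tuple 'I_n) :
  injective r -> (forall c, perm_eq (r c) c) ->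
  \sum_(f | @parking_function n f)
     #|[set c : k.-tuple 'I_n | uniq c & map_tuple f c == r c]|%:R <=
  #|[set f | @parking_function n f]|%:R * injection_prob n.+1 k.
Proof.
move=> rinj rperm; have [kn|nk] := leqP k n; first by rewrite sum_parking_card_mapE.
rewrite big1; first by rewrite !mulr_ge0 ?invr_ge0 ?exprn_ge0 ?ler0n.
move=> f _; apply/eqP; rewrite pnatr_eq0 cards_eq0; apply/eqP/setP => c.
rewrite !inE; apply/negbTE; apply: contraL nk => /andP[uc _]; rewrite -leqNgt.
by rewrite -(size_tuple c) -(card_uniqP uc) -[leqRHS]card_ord max_card.
Qed.

Lemma sum_num_cycles n :
  \sum_(f | @parking_function n f) (num_cycles f)%:R =
  #|[set f | @parking_function n f]|%:R * expected_cycles n.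
Proof.
under eq_bigr do rewrite num_cycles_by_size natr_sum.
rewrite exchange_big /= mulr_sumr; apply: eq_big_nat => k /andP[k0 kn].
rewrite mulrA.
have rinj : injective (fun c : k.-tuple 'I_n => rot_tuple 1 c).
  by move=> c c' /(congr1 val) /= /rot_inj /val_inj.
rewrite -(sum_parking_card_mapE rinj) // => [|c]; last first.
  by rewrite /= perm_rot.
rewrite mulr_suml; apply: eq_bigr => f _.
have k0' : k%:R != 0 :> R by rewrite pnatr_eq0 -lt0n.
apply: (mulIf k0'); rewrite mulfVK // -natrM mulnC -card_ufcycles //; congr (_%:R).
by apply: eq_card => c; rewrite !inE /ucycleb fcycleE andbC -val_eqE.
Qed.

Lemma ffact_add_le m j k : (m ^_ (j + k) <= m ^_ j * m ^_ k)%N.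
Proof.
elim: k => [|k IH]; first by rewrite addn0 ffactn0 muln1.
by rewrite addnS !ffactnSr mulnA leq_mul // leq_sub2l // leq_addl.
Qed.

Lemma injection_prob_add_le m j k :
  injection_prob m (j + k) <= injection_prob m j * injection_prob m k.
Proof.
rewrite /injection_prob mulrACA -invfM -exprD -natrM.
by rewrite ler_wpM2r ?invr_ge0 ?exprn_ge0 ?ler0n // ler_nat ffact_add_le.
Qed.

(** Diagonal pairs of cycles contribute the first moment; off-diagonal ones are
    counted by [card_dicycle_pairs] and decouple by submultiplicativity of
    [injection_prob]. *)
Lemma sum_num_cycles_sqr_le n :
  \sum_(f | @parking_function n f) (num_cycles f)%:R ^+ 2 <=
  #|[set f | @parking_function n f]|%:R *
    (expected_cycles n + expected_cycles n ^+ 2).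
Proof.
under eq_bigr do rewrite expr2 -natrM num_cycles_pairs_by_size natrD.
rewrite big_split /= sum_num_cycles mulrDr lerD2l.
under eq_bigr do rewrite natr_sum.
rewrite exchange_big /= expr2 mulr_suml mulr_sumr; apply: ler_sum_nat => j /andP[j0 _].
under eq_bigr do rewrite natr_sum.
rewrite exchange_big /= !mulr_sumr; apply: ler_sum_nat => k /andP[k0 _].
have jk0 : 0 < (j * k)%N%:R :> R by rewrite ltr0n muln_gt0 j0.
rewrite mulf_div -natrM mulrA ler_pdivlMr // mulr_suml.
apply: le_trans (_ :
    #|[set f | @parking_function n f]|%:R * injection_prob n.+1 (j + k) <= _);
  last first.
  by rewrite ler_wpM2l // injection_prob_add_le.
apply: le_trans (sum_parking_card_map_le (@rot_blocks_inj 'I_n j (j + k)) _); last first.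
  by move=> c; rewrite /= /rot_blocks -[X in perm_eq _ X](cat_take_drop j c) perm_cat // perm_rot.
apply: ler_sum => f _; rewrite -natrM ler_nat mulnC.
apply: leq_trans (card_dicycle_pairs f j k) _; apply: subset_leq_card.
by apply/fintype.subsetP => c; rewrite !inE.
Qed.

Lemma sum_num_cycles_dev_le n (a : R) :
  \sum_(f | @parking_function n f) ((num_cycles f)%:R - a) ^+ 2 <=
  #|[set f | @parking_function n f]|%:R *
    (expected_cycles n + (expected_cycles n - a) ^+ 2).
Proof.
have := sum_num_cycles_sqr_le n.
have -> : \sum_(f | @parking_function n f) ((num_cycles f)%:R - a) ^+ 2 =
   \sum_(f | @parking_function n f) (num_cycles f)%:R ^+ 2 -
   2 * a * (#|[set f | @parking_function n f]|%:R * expected_cycles n) +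
   #|[set f | @parking_function n f]|%:R * a ^+ 2.
  have -> : #|[set f | @parking_function n f]|%:R * a ^+ 2 =
     \sum_(f | @parking_function n f) a ^+ 2.
    by rewrite sumr_const mulr_natl cardsE.
  rewrite -sum_num_cycles mulr_sumr -sumrB -big_split /=.
  by apply: eq_bigr => f _; ring.
lra.
Qed.

End Moments.

(** * The expected number of cycles is half a logarithm *)

Section Asymptotics.
Variable R : realType.
Local Notation prob := (@injection_prob R).

Lemma injection_prob_ge0 m k : 0 <= prob m k.
Proof. by rewrite mulr_ge0 ?invr_ge0 ?exprn_ge0 ?ler0n. Qed.

Lemma injection_prob0 m : prob m 0 = 1.
Proof. by rewrite /injection_prob ffactn0 expr0 divr1. Qed.

(** Divided by m, both sides are the probability that value k + 1 is the first to
    repeat an earlier one; this is what makes the sum of the k p_k telescope. *)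
Lemma injection_prob_succ m k : (0 < m)%N ->
  k%:R * prob m k = m%:R * (prob m k - prob m k.+1).
Proof.
move=> m0; have m0' : m%:R != 0 :> R by rewrite pnatr_eq0 -lt0n.
rewrite /injection_prob; have [km|mk] := leqP k m; last first.
  by rewrite !ffact_small ?(ltnW mk) ?leqW // !mul0r subrr !mulr0.
rewrite ffactnSr natrM natrB // exprS invfM; field.
by rewrite m0' expf_neq0.
Qed.

Lemma injection_prob_le1 m k : (0 < m)%N -> prob m k <= 1.
Proof.
move=> m0; elim: k => [|k IH]; first by rewrite injection_prob0.
apply: le_trans IH; rewrite -subr_ge0.
have m0' : 0 < m%:R :> R by rewrite ltr0n.
by rewrite -(pmulr_rge0 _ m0') -injection_prob_succ // mulr_ge0 ?ler0n ?injection_prob_ge0.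
Qed.

Lemma injection_prob_ge m k : (0 < m)%N -> 1 - k%:R ^+ 2 / m%:R <= prob m k.
Proof.
move=> m0; have m0' : 0 < m%:R :> R by rewrite ltr0n.
elim: k => [|k IH]; first by rewrite injection_prob0 expr0n mul0r subr0.
have E : prob m k.+1 = prob m k - k%:R * prob m k / m%:R.
  by rewrite injection_prob_succ //; field; rewrite gt_eqF.
rewrite E; have : k%:R * prob m k / m%:R <= k%:R / m%:R.
  by rewrite ler_wpM2r ?invr_ge0 ?ler0n // ler_piMr ?injection_prob_le1.
have : k.+1%:R ^+ 2 / m%:R = k%:R ^+ 2 / m%:R + 2 * (k%:R / m%:R) + m%:R^-1 :> R.
  by rewrite -natr1; field; rewrite gt_eqF.
have : 0 <= m%:R^-1 :> R by rewrite invr_ge0 ltW.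
have : 0 <= k%:R / m%:R :> R by rewrite mulr_ge0 // invr_ge0 ltW.
lra.
Qed.

Lemma sum_index_injection_prob m j : (0 < m)%N ->
  \sum_(1 <= k < j.+1) k%:R * prob m k <= m%:R.
Proof.
move=> m0; under eq_bigr do rewrite injection_prob_succ //.
rewrite -mulr_sumr; under eq_bigr do rewrite -opprB.
rewrite sumrN telescope_sumr // opprB ler_piMr //.
by have := injection_prob_le1 1 m0; have := injection_prob_ge0 m j.+1; lra.
Qed.

Lemma harmonic_ge_ln s : ln s.+1%:R <= \sum_(1 <= k < s.+1) k%:R^-1 :> R.
Proof.
elim: s => [|s IH]; first by rewrite big_geq // ln1.
rewrite big_nat_recr //=.
have s0 : 0 < s.+1%:R :> R by rewrite ltr0n.
have -> : s.+2%:R = s.+1%:R * (1 + s.+1%:R^-1) :> R.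
  by rewrite -[s.+2%:R]natr1; field; rewrite gt_eqF.
rewrite lnM ?posrE ?addr_gt0 ?invr_gt0 // lerD //.
by apply: le_ln1Dx; apply: lt_trans (_ : 0 < _); rewrite ?invr_gt0 // ltrN10.
Qed.

(** The step is ln (s + 2) - ln (s + 1) >= 1 / (s + 2), from the tangent bound
    ln (1 + x) <= x at x = - 1 / (s + 2). *)
Lemma harmonic_le_ln s : (0 < s)%N ->
  \sum_(1 <= k < s.+1) k%:R^-1 <= 1 + ln s%:R :> R.
Proof.
case: s => // s _; elim: s => [|s IH]; first by rewrite big_nat1 invr1 ln1 addr0.
rewrite big_nat_recr //=.
have s0 : 0 < s.+1%:R :> R by rewrite ltr0n.
have s1 : 0 < s.+2%:R :> R by rewrite ltr0n.
suff : s.+2%:R^-1 <= ln s.+2%:R - ln s.+1%:R :> R.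
  rewrite lerBrDr => H; apply: le_trans (lerD IH (lexx _)) _.
  by rewrite -addrA lerD2l addrC.
have -> : ln s.+2%:R - ln s.+1%:R = - ln (1 + - s.+2%:R^-1) :> R.
  rewrite -ln_div ?posrE // -lnV ?posrE.
    congr ln; rewrite -[s.+2%:R]natr1; field.
    by rewrite addrK nat1r natr1 !gt_eqF ?ltr0n.
  by rewrite subr_gt0 invf_lt1 // ltr1n.
rewrite lerNr; apply: le_ln1Dx.
by rewrite ltrN2 invf_lt1 // ltr1n.
Qed.

Lemma nat_sqrt_exists m : exists s, (s * s <= m < s.+1 * s.+1)%N.
Proof.
elim: m => [|m [s /andP[sm ms]]]; first by exists 0%N.
have [lt|ge] := leqP (s.+1 * s.+1) m.+1.
  by exists s.+1; rewrite lt /=; nia.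
by exists s; rewrite ge andbT; lia.
Qed.

(** Split the sum at s, the integer square root of n + 1. *)
Lemma expected_cycles_near_ln n : (0 < n)%N ->
  `|expected_cycles R n - 2^-1 * ln n%:R| <= 3.
Proof.
move=> n0; have [s /andP[sN Ns]] := nat_sqrt_exists n.+1.
have s0 : (0 < s)%N by case: s Ns {sN}; lia.
have sn : (s <= n)%N by nia.
have N0 : 0 < n.+1%:R :> R by rewrite ltr0n.
have s0' : 0 < s%:R :> R by rewrite ltr0n.
have n0' : 0 < n%:R :> R by rewrite ltr0n.
have sN' : s%:R * s%:R <= n.+1%:R :> R by rewrite -natrM ler_nat.
have Ns' : n.+1%:R <= s.+1%:R * s.+1%:R :> R by rewrite -natrM ler_nat ltnW.
have lnn : ln n%:R <= ln n.+1%:R :> R by rewrite ler_ln ?posrE // ler_nat.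
have lnN : ln n.+1%:R <= 1 + ln n%:R :> R.
  apply: le_trans (_ : ln (2 * n%:R) <= _).
    by rewrite ler_ln ?posrE ?mulr_gt0 // -natrM ler_nat; lia.
  rewrite lnM ?posrE // lerD2r; have := @le_ln1Dx R 1; rewrite -[1 + 1]/2; apply.
  by rewrite ltrNl; lra.
have lns : 2 * ln s%:R <= ln n.+1%:R :> R.
  by rewrite mulr_natl mulr2n -lnM ?posrE // ler_ln ?posrE ?mulr_gt0.
have lns1 : ln n.+1%:R <= 2 * ln s.+1%:R :> R.
  by rewrite mulr_natl mulr2n -lnM ?posrE ?ltr0n // ler_ln ?posrE ?mulr_gt0 ?ltr0n.
have E : expected_cycles R n = \sum_(1 <= k < s.+1) prob n.+1 k / k%:R +
                             \sum_(s.+1 <= k < n.+1) prob n.+1 k / k%:R.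
  by rewrite -big_cat_nat.
have head_le : \sum_(1 <= k < s.+1) prob n.+1 k / k%:R <=
    \sum_(1 <= k < s.+1) k%:R^-1 :> R.
  by apply: ler_sum_nat => k _; rewrite ler_piMl ?invr_ge0 ?injection_prob_le1.
have head_ge : \sum_(1 <= k < s.+1) k%:R^-1 - 1 <=
    \sum_(1 <= k < s.+1) prob n.+1 k / k%:R.
  (* p_k / k >= 1 / k - k / N, and the s corrections k / N <= s / N add up to
     at most 1. *)
  apply: le_trans (_ : \sum_(1 <= k < s.+1) (k%:R^-1 - s%:R / n.+1%:R) <= _).
    rewrite sumrB sumr_const_nat subn1 /= lerD2l lerN2 -mulrnAl -[_ *+ s]mulr_natr.
    by rewrite ler_pdivrMr // mul1r.
  apply: ler_sum_nat => k /andP[k0 ks].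
  have k0' : 0 < k%:R :> R by rewrite ltr0n.
  apply: le_trans (_ : (1 - k%:R ^+ 2 / n.+1%:R) / k%:R <= _); last first.
    by rewrite ler_wpM2r ?invr_ge0 ?ler0n // injection_prob_ge.
  have -> : (1 - k%:R ^+ 2 / n.+1%:R) / k%:R = k%:R^-1 - k%:R / n.+1%:R :> R.
    by field; rewrite !gt_eqF.
  by rewrite lerD2l lerN2 ler_wpM2r ?invr_ge0 ?ler0n // ler_nat.
have tail_ge : 0 <= \sum_(s.+1 <= k < n.+1) prob n.+1 k / k%:R.
  by apply: sumr_ge0 => k _; rewrite mulr_ge0 ?invr_ge0 ?injection_prob_ge0.
(* For k > s, p_k / k <= k p_k / (s + 1)^2, and (s + 1)^2 > N. *)
have tail_le : \sum_(s.+1 <= k < n.+1) prob n.+1 k / k%:R <= 1.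
  have s1 : 0 < s.+1%:R * s.+1%:R :> R by rewrite -natrM ltr0n.
  rewrite -(ler_pM2r s1) mul1r; apply: le_trans Ns'.
  apply: le_trans (sum_index_injection_prob n (ltn0Sn n)).
  rewrite (@big_cat_nat _ _ _ s.+1 1 n.+1) //= mulr_suml.
  apply: le_trans (_ : _ <= \sum_(s.+1 <= k < n.+1) k%:R * prob n.+1 k) _; last first.
    by rewrite lerDr sumr_ge0 // => k _; rewrite mulr_ge0 ?injection_prob_ge0.
  apply: ler_sum_nat => k /andP[sk _].
  have k0' : 0 < k%:R :> R by rewrite ltr0n (leq_trans (ltn0Sn s) sk).
  rewrite mulrAC ler_pdivrMr // [leRHS]mulrAC [leRHS]mulrC.
  apply: ler_wpM2l; first exact: injection_prob_ge0.
  by rewrite -!natrM ler_nat leq_mul.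
have := harmonic_ge_ln s; have := harmonic_le_ln s0.
rewrite ler_norml E; lra.
Qed.

End Asymptotics.

(** * Concentration *)

Lemma uniform_on_probE (d : measure_display) (T : measurableType d)
    (R : realType) (P : probability T R) (V : finType) (A B : pred V) (X : T -> V) :
  uniform_on P A X ->
  P [set w | B (X w)]%classic = (#|[set v | A v & B v]|%:R / #|[set v | A v]|%:R)%:E.
Proof.
move=> XU.
have -> : [set w | B (X w)]%classic =
    (\bigcup_(v in [set v | B v]) (X @^-1` [set v]))%classic.
  by apply/seteqP; split=> [w Bw|w [v Bv /= ->]] //=; exists (X w).
rewrite measure_fin_bigcup //; [|exact: finite_finset| |]; last first.
- by move=> v _; have [] := XU v.
- by move=> v v' _ _ [w [/= <- <-]].
rewrite (eq_fsbigr (fun v => (if A v then #|A|%:R^-1 else 0)%:E)); last first.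
  by move=> v _; have [] := XU v.
rewrite (fsbigE (enum B)) ?enum_uniq //=; last 2 first.
- by move=> v /=; rewrite mem_enum.
- by move=> v Bv; rewrite mem_enum unfold_in Bv.
rewrite big_enum_cond /= (eq_bigl B) => [|v]; last first.
  by rewrite mem_setE andbb.
rewrite sumEFin; congr EFin.
rewrite -big_mkcondr /= sumr_const -[LHS]mulr_natl !cardsE.
by congr (_%:R / _); apply: eq_card => v; rewrite !unfold_in andbC.
Qed.

Lemma ln_natr_cvgy (R : realType) :
  ((fun n => ln (n%:R : R)) @ \oo --> +oo)%classic.
Proof.
apply/cvgryPge => A; near=> n.
have nA : expR A <= n%:R by near: n; exact: nbhs_infty_ger.
have n0 : 0 < n%:R :> R by apply: lt_le_trans nA; exact: expR_gt0.
by rewrite -[A]expRK ler_ln ?posrE ?expR_gt0.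
Unshelve. all: by end_near. Qed.

(** Chebyshev's inequality: the mean square deviation from a is at most
    M + (M - a)^2 <= (a + 3) + 9, which is at most 2 a as soon as a >= 12. *)
Lemma card_parking_deviation_le (R : realType) n (eps a : R) :
  (0 < n)%N -> a = 2^-1 * ln n%:R -> 12 <= a -> 0 < eps ->
  #|[set f | @parking_function n f & eps < `|(num_cycles f)%:R / a - 1|]|%:R /
  #|[set f | @parking_function n f]|%:R <= 2 / eps ^+ 2 * a^-1.
Proof.
move=> n0 aE a12 eps0.
have a0 : 0 < a by lra.
have ea0 : 0 < (eps * a) ^+ 2 by rewrite exprn_gt0 // mulr_gt0.
rewrite ler_pdivrMr ?card_parking_gt0 // -(ler_pM2r ea0).
apply: le_trans (_ : \sum_(f | @parking_function n f) ((num_cycles f)%:R - a) ^+ 2 <= _).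
  rewrite cardsE -sum1_card natr_sum mulr_suml.
  rewrite [leLHS](eq_bigl (fun f => @parking_function n f &&
     (eps < `|(num_cycles f)%:R / a - 1|))); last by move=> f; rewrite unfold_in.
  rewrite big_mkcondr; apply: ler_sum => f _; case: ifP => [lt|_]; last exact: sqr_ge0.
  have -> : (num_cycles f)%:R - a = ((num_cycles f)%:R / a - 1) * a.
    by rewrite mulrBl mul1r divfK // gt_eqF.
  rewrite mul1r !exprMn ler_wpM2r ?sqr_ge0 // -[leRHS]real_normK ?num_real //.
  by apply: lerXn2r; rewrite ?nnegrE ?normr_ge0 // ltW.
apply: le_trans (sum_num_cycles_dev_le n a) _.
have -> : 2 / eps ^+ 2 / a * #|[set f | @parking_function n f]|%:R * (eps * a) ^+ 2 =
  #|[set f | @parking_function n f]|%:R * (2 * a).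
  by field; rewrite !gt_eqF.
rewrite ler_wpM2l // ?ler0n //.
have := expected_cycles_near_ln R n0; rewrite -aE => le3.
have : (expected_cycles R n - a) ^+ 2 <= 3 ^+ 2.
  by rewrite -real_normK ?num_real // ler_sqr ?nnegrE.
move: le3; rewrite ler_norml => /andP[_ ?] ?; lra.
Qed.

Theorem theorem4p1 (R : realType) (d : nat -> measure_display)
    (T : forall n : nat, measurableType (d n))
    (P : forall n : nat, probability (T n) R)
    (pi : forall n : nat, T n -> {ffun 'I_n -> 'I_n})
    (pi_unif : forall n : nat,
      uniform_on (P n) (@parking_function n) (pi n)) :
  cvg_in_probability P
    (fun n w => (num_cycles (pi n w))%:R / (2^-1 * ln (n%:R : R))) 1.
Proof.
move=> eps eps0.
pose a n : R := 2^-1 * ln n%:R.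
have ay : (a n @[n --> \oo] --> +oo)%classic.
  apply/cvgryPge => A; have /cvgryPge/(_ (2 * A)) := @ln_natr_cvgy R.
  by apply: filterS => n; rewrite /a; lra.
have a0 : ((a n)^-1 @[n --> \oo] --> (0 : R))%classic.
  apply/gtr0_cvgV0 => //; move/cvgryPge/(_ 1): ay.
  by apply: filterS => n; apply: lt_le_trans.
apply: (@squeeze_cvge _ _ _ _ (cst 0%:E) _ (fun n => (2 / eps ^+ 2 * (a n)^-1)%:E)).
- have /cvgryPge/(_ 12) := ay; move: (nbhs_infty_gt 0); apply: filterS2 => n n0 a12.
  rewrite measure_ge0 /=.
  rewrite (uniform_on_probE (fun f => eps < `|(num_cycles f)%:R / a n - 1|) (pi_unif n)).
  by rewrite lee_fin card_parking_deviation_le.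
- exact: cvg_cst.
- apply: cvg_EFin; first exact: nearW.
  rewrite -[X in (_ --> X)%classic](mulr0 (2 / eps ^+ 2)).
  by apply: cvgMl_tmp.
Qed.
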